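(* Let $G=(V,E,s,t)$ be a directed multigraph with finite arc set $E$ and two distinguished vertices $s,t\in V$ (possibly equal). Let $V'$ be the set of nonsinks of $G$. The path-missing complex $\mathcal{PM}(G)$ has one of the following two homotopy types: (a) If $G$ contains a useless arc or a cycle, or satisfies ($E=\varnothing$ and $s\neq t$), then $\mathcal{PM}(G)$ is contractible. (b) Otherwise, $\mathcal{PM}(G)$ is homotopy-equivalent to a sphere of dimension $\#E-\#V'-1$.
   Context: Graphs are directed multigraphs; each arc has a source and a target in $V$; parallel arcs and self-loops are allowed. A walk from $v_0$ to $v_n$ is a sequence $(v_0,e_1,v_1,\ldots,e_n,v_n)$ with $n\ge 0$, $v_i\in V$, $e_i\in E$, where each $e_i$ is an arc from $v_{i-1}$ to $v_i$. A path is a walk that does not visit any vertex more than once; an $s-t$-path is a path from $s$ to $t$ (if $s=t$, this is the trivial path with no arcs). A cycle is a walk with $n\ge1$, $v_0=v_n$ and $v_0,\ldots,v_{n-1}$ distinct (so a self-loop gives a cycle). A nonsink is a vertex that is the source of at least one arc. A useless arc is an arc that belongs to no $s-t$-path. A set $F\subseteq E$ contains a path if it contains every arc of it. A simplicial complex on a finite ground set $W$ is a set $\Delta$ of subsets of $W$ (its faces) closed under taking subsets; $\Delta=\varnothing$ is allowed, as is $\Delta=\{\varnothing\}$, and singletons need not be faces. The path-missing complex is $\mathcal{PM}(G)=\{F\subseteq E : E\setminus F \text{ contains an } s-t\text{-path}\}$, with ground set $E$. Homotopy notions for a complex refer to its geometric realization. Conventions: the empty complex $\Delta=\varnothing$ (with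 no faces at all) is considered contractible; a complex $\Delta$ is said to be ''homotopy-equivalent to a sphere of dimension $-1$'' if $\Delta=\{\varnothing\}$. *)

(* Defs.v *)
From HB Require Import structures.
From mathcomp Require Import all_boot all_order all_algebra.
From mathcomp Require Import finmap.
From mathcomp Require Import boolp classical_sets functions reals topology.
From mathcomp Require Import normedtype.

Set Implicit Arguments.
Unset Strict Implicit.
Unset Printing Implicit Defensive.

Import Order.TTheory GRing.Theory Num.Theory.
Import numFieldNormedType.Exports.

(* The vertex set may be infinite; only the arc set is assumed finite. *)
Record multigraph (V : choiceType) (E : finType) := Multigraph {
  source : E -> V;
  target : E -> V
}.

Section Multigraph.
Context {V : choiceType} {E : finType} (G : multigraph V E).

(* A walk (v_0, e_1, v_1, ..., e_n, v_n) is encoded by its initial vertex v_0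
   and its arcs [:: e_1; ...; e_n]; the other vertices are v_i = target e_i. *)
Fixpoint is_walk (u : V) (p : seq E) (v : V) : bool :=
  if p is e :: p' then (source G e == u) && is_walk (target G e) p' v
  else u == v.

Definition is_path (u : V) (p : seq E) (v : V) : bool :=
  is_walk u p v && uniq (u :: [seq target G e | e <- p]).

(* On a walk, v_0, ..., v_{n-1} are the sources of e_1, ..., e_n. *)
Definition is_cycle (u : V) (p : seq E) : bool :=
  [&& p != [::], is_walk u p u & uniq [seq source G e | e <- p]].

Definition has_cycle : Prop := exists u p, is_cycle u p.

Definition nonsinks : {fset V} := [fset source G e | e in E]%fset.

Definition useless_arc (s t : V) (e : E) : Prop :=
  forall p : seq E, is_path s p t -> e \notin p.

Definition contains_path (s t : V) (F : {set E}) : Prop :=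
  exists2 p : seq E, is_path s p t & {subset p <= F}.

End Multigraph.

Record complex (W : finType) := Complex {
  faces :> {set {set W}};
  faces_closed : forall F F' : {set W},
    F' \subset F -> F \in faces -> F' \in faces
}.

Section PathMissing.
Context {V : choiceType} {E : finType} (G : multigraph V E) (s t : V).

Definition path_missing_faces : {set {set E}} :=
  [set F : {set E} | `[< contains_path G s t (~: F) >] ]%SET.

Lemma path_missing_closed (F F' : {set E}) :
  F' \subset F -> F \in path_missing_faces -> F' \in path_missing_faces.
Proof.
rewrite !finset.in_set => sF'F /asboolP[p pst pF]; apply/asboolP.
exists p => // e /pF; rewrite !finset.in_setC; apply: contra.
exact: (fintype.subsetP sF'F).
Qed.

Definition path_missing : complex E := Complex path_missing_closed.

End PathMissing.

Local Open Scope classical_set_scope.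
Local Open Scope ring_scope.

Section Homotopy.
Context (R : realType).

Definition homotopic (X Y : topologicalType) (f g : X -> Y) : Prop :=
  exists H : X * R -> Y,
    [/\ {within [set: X] `*` `[0, 1], continuous H},
        forall x, H (x, 0) = f x &
        forall x, H (x, 1) = g x].

Definition homotopy_equivalent (X Y : topologicalType) : Prop :=
  exists (f : X -> Y) (g : Y -> X),
    [/\ continuous f, continuous g,
        homotopic (g \o f) id & homotopic (f \o g) id].

Definition contractible (X : topologicalType) : Prop :=
  exists x0 : X, homotopic id (fun _ : X => x0).

Definition sphere (n : nat) : topologicalType :=
  set_type [set x : {ptws 'I_n.+1 -> R} | \sum_i x i ^+ 2 = 1].

(* Barycentric coordinates. The face set0 contributes no point, since the
   coordinates sum to 1: both Delta = set0 and Delta = [set set0] have an empty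
   realization, hence the conventions in the two definitions below. *)
Definition realization (W : finType) (Delta : complex W) : topologicalType :=
  set_type [set x : {ptws W -> R} |
    [/\ forall w, 0 <= x w, \sum_w x w = 1 &
        [set w | x w != 0]%SET \in faces Delta]].

Definition complex_contractible (W : finType) (Delta : complex W) : Prop :=
  faces Delta = finset.set0 \/ contractible (realization Delta).

(* No complex is a sphere of dimension less than -1 = Negz 0. *)
Definition complex_sphere (W : finType) (Delta : complex W) (d : int) : Prop :=
  match d with
  | Posz n => homotopy_equivalent (realization Delta) (sphere n)
  | Negz 0 => faces Delta = [set finset.set0]%SET
  | Negz _.+1 => False
  end.

End Homotopy.

(* Main.v *)
(* Give each arc e the length x_e, where x is a point of the realization, and
   let d(v) be the distance from v to t.  If there are no useless arcs, the
   reduced cost rho(x)_e = x_e + d(target e) - d(source e) is nonnegative and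
   nonzero, and it vanishes on every s-t-path on which x does.  Hence the
   complex is pushed along the segments from x to rho(x) onto the points where
   every nonsink has an outgoing arc of weight zero.
   - Acyclic case.  All such points lie in the complex, since following arcs of
     weight zero leads to t.  So they form the join, over the nonsinks v, of the
     boundaries of the simplices on the arcs leaving v.  The differences
     x_e - x_b, where b is a fixed arc with the same source as e, map this join
     bijectively to a sphere, up to rescaling.
   - A cycle C.  The reduced costs around C add up to the length of C, so
     rho((1 - a) x + a 1_C) is never zero, and it contracts the complex to a
     point as a goes from 0 to 1.
   A useless arc is the apex of a cone, unless there are no faces at all. *)
Require Import Defs.
From mathcomp Require Import all_boot all_order all_algebra finmap reals.
From mathcomp Require Import boolp classical_sets functions topology normedtype.
From mathcomp Require Import realfun lra.

Set Implicit Arguments.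
Unset Strict Implicit.
Unset Printing Implicit Defensive.

Import Order.TTheory GRing.Theory Num.Theory.
Import numFieldNormedType.Exports.
Local Open Scope ring_scope.

(** * Walks and paths *)

Section Walks.
Context {V : choiceType} {E : finType} (G : multigraph V E).
Implicit Types (u v w s t : V) (e f : E) (p q : seq E).

Lemma is_walk_cat u v w p q :
  is_walk G u p v -> is_walk G v q w -> is_walk G u (p ++ q) w.
Proof.
elim: p u => [|e p IH] u /=; first by move=> /eqP->.
by move=> /andP[-> /IH h] /h.
Qed.

Lemma is_walk_split u w e p q :
  is_walk G u (p ++ e :: q) w ->
  is_walk G u p (source G e) /\ is_walk G (target G e) q w.
Proof.
elim: p u => [|f p IH] u /=; first by rewrite eq_sym => /andP[-> ->].
by move=> /andP[-> /IH].
Qed.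

Lemma path_uniq u p v : is_path G u p v -> uniq p.
Proof. by move=> /andP[_ /= /andP[_ /map_uniq]]. Qed.

Lemma path_behead u e p v :
  is_path G u (e :: p) v -> is_path G (target G e) p v.
Proof. by rewrite /is_path /= => /andP[/andP[_ ->] /andP[_ ->]]. Qed.

(** The walk ends in [v], so after an arc leaving [v] it would meet [v] a second time. *)
Lemma path_source_neq u p v e : is_path G u p v -> e \in p -> source G e != v.
Proof.
elim: p u => [//|f p IH] u puv; rewrite inE => /orP[/eqP->|]; last first.
  exact: IH (path_behead puv).
move: puv => /andP[/= /andP[/eqP-> ] wp /andP[up _]].
apply: contraNneq up => ->; move: wp {IH}; rewrite inE.
elim: p (target G f) => [|g p IH] w /= => [/eqP->|/andP[_ /IH]].
  by rewrite eqxx.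
by rewrite inE => /orP[] ->; rewrite !orbT.
Qed.

Lemma path_suffix u p v w :
  is_path G u p v -> w \in u :: [seq target G e | e <- p] ->
  exists2 q, is_path G w q v & {subset q <= p}.
Proof.
elim: p u => [|e p IH] u puv.
  by rewrite inE => /eqP->; exists [::].
rewrite in_cons => /orP[/eqP->|wp]; first by exists (e :: p).
have [q qwv sqp] := IH _ (path_behead puv) wp.
by exists q => // f /sqp; rewrite inE => ->; rewrite orbT.
Qed.

Lemma path_after u p v e : is_path G u p v -> e \in p ->
  exists2 q, is_path G (target G e) q v & {subset q <= p}.
Proof.
move=> puv ep; apply: path_suffix puv _.
by rewrite inE (map_f (target G)) ?orbT.
Qed.

(** Induction from the end: if the new source already lies on the path found so far, that path is
    cut down to its part starting there. *)
Lemma walk_to_path u p v : is_walk G u p v ->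
  exists2 q, is_path G u q v & {subset q <= p}.
Proof.
elim: p u => [|e p IH] u /=.
  by move=> /eqP->; exists [::] => //; rewrite /is_path /= eqxx.
move=> /andP[/eqP <- /IH[q pq sqp]].
have [sq|sq] := boolP (source G e \in target G e :: [seq target G f | f <- q]).
  have [q' pq' sq'q] := path_suffix pq sq.
  by exists q' => // f /sq'q/sqp; rewrite inE => ->; rewrite orbT.
exists (e :: q).
  by move: pq sq; rewrite /is_path /= eqxx => /andP[-> ->] ->.
by move=> f; rewrite !inE => /orP[->//|/sqp->]; rewrite orbT.
Qed.

(** If the first source recurred, the arcs before the recurrence would form a cycle, the later
    sources being distinct by induction. *)
Lemma acyclic_walk_uniq u p v : ~ has_cycle G -> is_walk G u p v -> uniq p.
Proof.
move=> ncyc wp; suff: uniq [seq source G e | e <- p] by move=> /map_uniq.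
elim: p u wp => [//|e p IH] u /= /andP[/eqP eu wp].
rewrite (IH _ wp) andbT; apply/negP => sp.
have [f fp ef] := mapP sp; move: wp (IH _ wp) sp; rewrite ef.
case: (@path.splitPr _ _ _ fp) => p1 p2 w12; rewrite map_cat cat_uniq /=.
move=> /and3P[u1 /norP[nf _] _] _; case: ncyc; exists (source G e), (e :: p1).
have [w1 _] := is_walk_split w12; rewrite /is_cycle /= eqxx ef w1 /=.
by rewrite nf u1.
Qed.

(* Repeatedly leaving the current vertex along an arc of [P] must stop, as
   walks of an acyclic graph have at most [#|E|] arcs. *)
Lemma acyclic_greedy_walk (Q : V -> Prop) (P : E -> Prop) t : ~ has_cycle G ->
  (forall v, Q v -> v = t \/
    exists e, [/\ P e, source G e = v & Q (target G e)]) ->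
  forall v, Q v -> exists2 p, is_walk G v p t & forall e, e \in p -> P e.
Proof.
move=> ncyc step v Qv; apply: contrapT => nwalk.
suff: forall n, exists p w, [/\ is_walk G v p w, size p = n, Q w &
    forall e, e \in p -> P e].
  move=> /(_ #|E|.+1)[p [w [wp sp _ _]]].
  have := uniq_leq_size (acyclic_walk_uniq ncyc wp)
    (fun e _ => mem_enum predT e).
  by rewrite sp -cardE ltnn.
elim=> [|n [p [w [wp sp Qw Pp]]]]; first by exists [::], v; split => //=.
have [wt|[e [Pe ew Qe]]] := step _ Qw.
  by case: nwalk; exists p; rewrite -?wt.
exists (rcons p e), (target G e); rewrite -cats1 size_cat sp addn1.
split=> //; first by apply: is_walk_cat wp _; rewrite /= ew !eqxx.
by move=> f; rewrite mem_cat inE => /orP[/Pp|/eqP->].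
Qed.

End Walks.

(** * Shortest paths and reduced costs *)

Lemma ler_sum_subset (R : numDomainType) (I : eqType) (y : I -> R)
    (p q : seq I) :
  (forall i, 0 <= y i) -> uniq p -> {subset p <= q} ->
  \sum_(i <- p) y i <= \sum_(i <- q) y i.
Proof.
move=> y0; elim: p q => [|i p IH] q /=; first by rewrite big_nil sumr_ge0.
move=> /andP[ip up] sub; have iq : i \in q by rewrite sub ?mem_head.
rewrite big_cons (perm_big _ (perm_to_rem iq)) big_cons lerD2l; apply: IH => //.
move=> j jp; have := sub j; rewrite inE jp orbT => /(_ isT).
rewrite (perm_mem (perm_to_rem iq)) inE => /orP[/eqP ji|//].
by rewrite -ji jp in ip.
Qed.

Section ReducedCost.
Context {R : realType} {V : choiceType} {E : finType}.
Context (G : multigraph V E) (t : V).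
Implicit Types (u v w s : V) (e f : E) (p q : seq E) (x y : E -> R).

(* The length of a shortest path from [v] to [t] for the arc lengths [y]; when
   there is no such path, it is the total length of all arcs. *)
Definition dist y v : R :=
  \big[Num.min/(\sum_e y e)]_(A : {set E} | `[< contains_path G v t A >])
    \sum_(e in A) y e.

Definition reduced_cost y e : R :=
  y e + dist y (target G e) - dist y (source G e).

Lemma dist_ge0 y v : (forall e, 0 <= y e) -> 0 <= dist y v.
Proof. by move=> y0; apply: le_bigmin => [|A _]; exact: sumr_ge0. Qed.

Lemma dist_le_walk y v p : (forall e, 0 <= y e) -> is_walk G v p t ->
  dist y v <= \sum_(e <- p) y e.
Proof.
move=> y0 /walk_to_path[q qvt sqp]; have uq := path_uniq qvt.
apply: le_trans (ler_sum_subset y0 uq sqp); rewrite big_uniq //=.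
have := @bigmin_inf _ _ _ (\sum_e y e) [set e in q]%SET
  (fun A => `[< contains_path G v t A >]) _ (fun A => \sum_(e in A) y e).
apply; first by apply/asboolP; exists q => // e; rewrite inE.
by rewrite le_eqVlt; apply/orP; left; apply/eqP/eq_bigl => e; rewrite inE.
Qed.

Lemma dist_attained y v p : (forall e, 0 <= y e) -> is_walk G v p t ->
  exists2 q, is_path G v q t & dist y v = \sum_(e <- q) y e.
Proof.
move=> y0 /walk_to_path[q qvt sqp].
(* The default [\sum_e y e] bounds all these sums from above, so the minimum is attained at some
   [A]; the path [r] inside [A] is no longer than that. *)
have [||A /asboolP[r rvt srA] dA] := @eq_bigmin _ _ _ (\sum_e y e) [set: E]%SET
  (fun A => `[< contains_path G v t A >]) (fun A => \sum_(e in A) y e).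
- by apply/asboolP; exists q => // e; rewrite inE.
- move=> A _; rewrite [leRHS](bigID (fun e => e \in A)) /=.
  by rewrite lerDl sumr_ge0.
have ur := path_uniq rvt; exists r => //; apply/eqP; rewrite eq_le.
rewrite dist_le_walk //=; last by move/andP: rvt => [].
rewrite /dist dA -[leRHS]big_enum; apply: ler_sum_subset => // e /srA.
by rewrite mem_enum.
Qed.

Lemma dist_sink y : (forall e, 0 <= y e) -> dist y t = 0.
Proof.
move=> y0; apply/eqP; rewrite eq_le dist_ge0 // andbT.
by have := @dist_le_walk y t [::] y0; rewrite big_nil /= eqxx; exact.
Qed.

(** The distances telescope along the walk. *)
Lemma sum_reduced_cost y u p v : is_walk G u p v ->
  \sum_(e <- p) reduced_cost y e = \sum_(e <- p) y e + dist y v - dist y u.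
Proof.
elim: p u => [|e p IH] u /= => [/eqP->|/andP[/eqP<- /IH IHp]].
  by rewrite !big_nil add0r subrr.
by rewrite !big_cons IHp /reduced_cost; lra.
Qed.

(** Triangle inequality: [e] followed by a shortest path from its target is a walk from its
    source. *)
Lemma reduced_cost_ge0 y e p : (forall e, 0 <= y e) ->
  is_walk G (target G e) p t -> 0 <= reduced_cost y e.
Proof.
move=> y0 wp; rewrite subr_ge0; have [q /andP[wq _] ->] := dist_attained y0 wp.
by have := @dist_le_walk y (source G e) (e :: q) y0; rewrite big_cons /= eqxx;
  exact.
Qed.

(** On a shortest path the reduced costs add up to 0; being nonnegative, each of them is 0. *)
Lemma tight_path y v p : (forall e, 0 <= y e) ->
  (forall e, 0 <= reduced_cost y e) -> is_walk G v p t ->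
  exists2 q, is_path G v q t & forall e, e \in q -> reduced_cost y e = 0.
Proof.
move=> y0 r0 wp; have [q qvt dq] := dist_attained y0 wp.
exists q => // e eq; have wq : is_walk G v q t by move/andP: qvt => [].
have := sum_reduced_cost y wq; rewrite dq dist_sink // addr0 subrr => /eqP.
by rewrite psumr_eq0 // => /allP/(_ e eq) /= /eqP.
Qed.

End ReducedCost.

(** * Points of realizations and spheres *)

Section ContinuousReal.
Context {R : realType} {T : topologicalType}.
Implicit Types f g : T -> R.

Lemma continuousrD f g :
  continuous f -> continuous g -> continuous (fun a => f a + g a).
Proof. by move=> cf cg a; apply: cvgD; [exact: cf|exact: cg]. Qed.

Lemma continuousrB f g :
  continuous f -> continuous g -> continuous (fun a => f a - g a).
Proof. by move=> cf cg a; apply: cvgB; [exact: cf|exact: cg]. Qed.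

Lemma continuousrM f g :
  continuous f -> continuous g -> continuous (fun a => f a * g a).
Proof. by move=> cf cg a; apply: cvgM; [exact: cf|exact: cg]. Qed.

Lemma continuousr_div f g : (forall a, g a != 0) ->
  continuous f -> continuous g -> continuous (fun a => f a / g a).
Proof.
move=> g0 cf cg a; apply: cvgM; first exact: cf.
by apply: cvgV; [exact: g0|exact: cg].
Qed.

Lemma continuousr_min f g :
  continuous f -> continuous g -> continuous (fun a => Num.min (f a) (g a)).
Proof. by move=> cf cg a; apply: continuous_min; [exact: cf|exact: cg]. Qed.

Lemma continuousr_max f g :
  continuous f -> continuous g -> continuous (fun a => Num.max (f a) (g a)).
Proof. by move=> cf cg a; apply: continuous_max; [exact: cf|exact: cg]. Qed.

Lemma continuousr_sum (I : Type) (r : seq I) (P : pred I) (F : I -> T -> R) :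
  (forall i, continuous (F i)) ->
  continuous (fun a => \sum_(i <- r | P i) F i a).
Proof.
move=> cF; elim: r => [|i r IH].
  by under eq_fun do rewrite big_nil; exact: cst_continuous.
under eq_fun do rewrite big_cons; case: (P i) => //.
exact: continuousrD.
Qed.

Lemma continuousr_bigmin (I : Type) (r : seq I) (P : pred I) f
    (F : I -> T -> R) : continuous f -> (forall i, continuous (F i)) ->
  continuous (fun a => \big[Num.min/f a]_(i <- r | P i) F i a).
Proof.
move=> cf cF; elim: r => [|i r IH]; first by under eq_fun do rewrite big_nil.
under eq_fun do rewrite big_cons; case: (P i) => //.
exact: continuousr_min.
Qed.

Lemma continuous_coord (W : eqType) (A : set {ptws W -> R}) (w : W) :
  continuous (fun x : set_type A => set_val x w).
Proof.
move=> x.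
apply: (@continuous_comp _ _ _ set_val (fun y : {ptws W -> R} => y w)).
  exact: initial_continuous.
exact: (@proj_continuous W (fun=> R) w (set_val x)).
Qed.

Lemma continuous_to_ptws_sub (W : eqType) (A : set {ptws W -> R})
    (H : T -> set_type A) :
  (forall w, continuous (fun a => set_val (H a) w)) -> continuous H.
Proof.
move=> cH; apply: continuous_comp_initial => a; apply/cvg_sup => w U.
have /= -> := @nbhsE (initial_topology (fun f : W -> R => f w)) (set_val (H a)).
case=> B [[C oC <-] Ca] /filterS; apply; apply: (cH w).
exact: open_nbhs_nbhs.
Qed.

End ContinuousReal.

Section Realization.
Context {R : realType} {W : finType} {Delta : complex W}.
Implicit Types (x : realization R Delta) (y : W -> R) (w : W).

Definition bary x : W -> R := set_val x.

(** Barycentric coordinates before normalization: division by the positive sum gives a point of the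
    realization, so maps and homotopies can be given by unnormalized formulas. *)
Definition weights y : Prop :=
  [/\ forall w, 0 <= y w, exists w, y w != 0 &
      [set w | y w != 0]%SET \in faces Delta].

Lemma bary_inj x x' : (forall w, bary x w = bary x' w) -> x = x'.
Proof. by move=> xx'; apply/val_inj/funext. Qed.

Lemma bary_sum x : \sum_w bary x w = 1.
Proof. by have [] := set_mem (valP x). Qed.

Lemma bary_ge0 x w : 0 <= bary x w.
Proof. by have [+ _ _] := set_mem (valP x); exact. Qed.

Lemma bary_neq0 x : exists w, bary x w != 0.
Proof.
apply/existsP; rewrite -negb_forall; apply/negP => /forallP x0.
have := bary_sum x; rewrite big1 => [/esym/eqP|w _]; last exact/eqP.
by rewrite oner_eq0.
Qed.

Lemma bary_face x : [set w | bary x w != 0]%SET \in faces Delta.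
Proof. by have [] := set_mem (valP x). Qed.

Lemma weights_sum y : weights y -> 0 < \sum_w y w.
Proof.
move=> [y0 [w yw] _]; rewrite lt0r sumr_ge0 // andbT psumr_neq0 //.
by apply/hasP; exists w; rewrite ?mem_index_enum //= lt0r yw y0.
Qed.

Lemma continuous_bary w : continuous (fun x => bary x w).
Proof. exact: continuous_coord. Qed.

Lemma normalize_weights (T : topologicalType) (h : T -> W -> R) :
  (forall w, continuous (h^~ w)) -> (forall a, weights (h a)) ->
  exists2 H : T -> realization R Delta, continuous H &
    forall a w, bary (H a) w = h a w / \sum_w h a w.
Proof.
move=> ch hw; have s0 a : 0 < \sum_w h a w by apply: weights_sum.
have hP a : [/\ forall w, 0 <= h a w / \sum_w h a w,
    \sum_w h a w / \sum_w h a w = 1 &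
    [set w | h a w / \sum_w h a w != 0]%SET \in faces Delta].
  have [h0 _ hf] := hw a; split=> [w||].
  - by rewrite divr_ge0 // ltW.
  - by rewrite -mulr_suml divff // gt_eqF.
  - rewrite (_ : finset _ = [set w | h a w != 0]%SET) //; apply/setP => w.
    by rewrite !inE mulf_eq0 invr_eq0 (gt_eqF (s0 a)) orbF.
exists (fun a => exist _ (fun w => h a w / \sum_w h a w : R)
  (mem_set (hP a))) => //.
apply: (@continuous_to_ptws_sub R T W) => w /=.
apply: continuousr_div; [|exact: ch|exact: continuousr_sum].
by move=> a; rewrite gt_eqF.
Qed.

Lemma homotopic_weights (h : realization R Delta * R -> W -> R)
    (f g : realization R Delta -> realization R Delta) :
  (forall w, continuous (h^~ w)) -> (forall a, weights (h a)) ->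
  (forall x w, bary (f x) w = h (x, 0) w / \sum_w h (x, 0) w) ->
  (forall x w, bary (g x) w = h (x, 1) w / \sum_w h (x, 1) w) ->
  homotopic R f g.
Proof.
move=> ch hw h0 h1; have [H cH HE] := normalize_weights ch hw.
exists H; split=> [|x|x]; first exact: continuous_subspaceT.
- by apply: bary_inj => w; rewrite HE h0.
- by apply: bary_inj => w; rewrite HE h1.
Qed.

Lemma contractible_weights (h : realization R Delta * R -> W -> R) y :
  (forall w, continuous (h^~ w)) -> (forall a, weights (h a)) -> weights y ->
  (forall x w, h (x, 0) w = bary x w) -> (forall x w, h (x, 1) w = y w) ->
  contractible R (realization R Delta).
Proof.
move=> ch hw yw h0 h1.
have [|H _ HE] := @normalize_weights R (fun=> y) _ (fun=> yw).
  by move=> w; exact: cst_continuous.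
exists (H 0); apply: (homotopic_weights ch hw) => x w.
  rewrite h0 (_ : \sum_w _ = 1) ?divr1 // -(bary_sum x).
  by apply: eq_bigr => w' _; exact: h0.
rewrite HE h1; congr (_ / _); by apply: eq_bigr => w' _; rewrite h1.
Qed.

Lemma continuous_bary_fst (T : topologicalType) w :
  continuous (fun a : realization R Delta * T => bary a.1 w).
Proof.
move=> a; apply: (@continuous_comp _ _ _ fst (fun x => bary x w)).
  exact: cvg_fst.
exact: continuous_bary.
Qed.

End Realization.

Section Sphere.
Context {R : realType} {n : nat}.
Implicit Types (z : sphere R n) (i : 'I_n.+1).

Definition scoord z : 'I_n.+1 -> R := set_val z.

Lemma scoord_inj z z' : (forall i, scoord z i = scoord z' i) -> z = z'.
Proof. by move=> zz'; apply/val_inj/funext. Qed.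

Lemma scoord_sum z : \sum_i scoord z i ^+ 2 = 1.
Proof. exact: set_mem (valP z). Qed.

Lemma continuous_scoord i : continuous (fun z => scoord z i).
Proof. exact: continuous_coord. Qed.

Lemma sum_sqr_gt0 (y : 'I_n.+1 -> R) : (exists i, y i != 0) ->
  0 < \sum_i y i ^+ 2.
Proof.
move=> [i yi]; have s0 j : 0 <= y j ^+ 2 by exact: sqr_ge0.
rewrite lt0r sumr_ge0 // andbT psumr_neq0 //; apply/hasP.
by exists i; rewrite ?mem_index_enum //= exprn_even_gt0.
Qed.

Lemma normalize_sphere (T : topologicalType) (h : T -> 'I_n.+1 -> R) :
  (forall i, continuous (h^~ i)) -> (forall a, exists i, h a i != 0) ->
  exists2 H : T -> sphere R n, continuous H &
    forall a i, scoord (H a) i = h a i / Num.sqrt (\sum_i h a i ^+ 2).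
Proof.
move=> ch h0; have s0 a := sum_sqr_gt0 (h0 a).
have hP a : \sum_i (h a i / Num.sqrt (\sum_i h a i ^+ 2)) ^+ 2 = 1.
  under eq_bigr do rewrite exprMn exprVn sqr_sqrtr ?(ltW (s0 a)) //.
  by rewrite -mulr_suml divff // gt_eqF.
exists (fun a => exist _ (fun i => h a i / Num.sqrt (\sum_i h a i ^+ 2) : R)
  (mem_set (hP a))) => //.
apply: (@continuous_to_ptws_sub R T) => i /=; apply: continuousr_div => //.
  by move=> a; rewrite gt_eqF // sqrtr_gt0.
move=> a.
apply: (@continuous_comp _ _ _ (fun a => \sum_i h a i ^+ 2)); last first.
  exact: sqrt_continuous.
by apply: continuousr_sum => j; apply: continuousrM.
Qed.

End Sphere.

(** * The homotopy type of the path-missing complex *)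

Section Clip.
Context {R : realType}.

(** Retraction of the line onto [0, 1]: [homotopic] asks for a function of all real times, so the
    formulas must make sense outside [0, 1]. *)
Definition clip (r : R) : R := Num.min 1 (Num.max 0 r).

Lemma clip_ge0 r : 0 <= clip r.
Proof. by rewrite le_min ler01 le_max lexx. Qed.

Lemma clip_le1 r : clip r <= 1.
Proof. by rewrite ge_min lexx. Qed.

Lemma clip_le0 r : r <= 0 -> clip r = 0.
Proof. by move=> r0; rewrite /clip max_l // min_r // ler01. Qed.

Lemma clip_ge1 r : 1 <= r -> clip r = 1.
Proof.
by move=> r1; rewrite /clip max_r ?(le_trans ler01 r1) // min_l.
Qed.

Lemma continuous_clip (T : topologicalType) (f : T -> R) :
  continuous f -> continuous (fun a => clip (f a)).
Proof.
move=> cf; apply: continuousr_min; first exact: cst_continuous.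
by apply: continuousr_max => //; exact: cst_continuous.
Qed.

Lemma continuous_clip_snd (T : topologicalType) :
  continuous (fun a : T * R => clip a.2).
Proof. by apply: continuous_clip => a; exact: cvg_snd. Qed.

End Clip.

Section ReducedCostContinuity.
Context {R : realType} {V : choiceType} {E : finType}.
Context (G : multigraph V E) (t : V) (T : topologicalType) (y : T -> E -> R).
Hypothesis cy : forall e, continuous (y^~ e).

Lemma continuous_dist v : continuous (fun a => dist G t (y a) v).
Proof.
by apply: continuousr_bigmin => [|A]; apply: continuousr_sum.
Qed.

Lemma continuous_reduced_cost e :
  continuous (fun a => reduced_cost G t (y a) e).
Proof.
apply: continuousrB; last exact: continuous_dist.
by apply: continuousrD => //; exact: continuous_dist.
Qed.

End ReducedCostContinuity.

(** * Useless arcs and cones *)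

Section PathMissing.
Context {R : realType} {V : choiceType} {E : finType}.
Context {G : multigraph V E} {s t : V}.
Implicit Types (v : V) (e f : E) (p q : seq E) (y : E -> R).

Lemma face_supportP y :
  [set e | y e != 0]%SET \in faces (path_missing G s t) <->
  exists2 p, is_path G s p t & forall e, e \in p -> y e = 0.
Proof.
rewrite /= finset.in_set; split=> [/asboolP|] [p pst py].
  by exists p => // e /py; rewrite !inE negbK => /eqP.
by apply/asboolP; exists p => // e /py ye; rewrite !inE ye eqxx.
Qed.

Lemma useless_arc_contractible e :
  useless_arc G s t e -> complex_contractible R (path_missing G s t).
Proof.
move=> ue; have [[F Fin]|none] :=
  pselect (exists F, F \in path_missing_faces G s t); last first.
  left; apply/setP => F; rewrite [RHS]inE; apply/negP => Fin.
  by case: none; exists F.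
right; have [p pst _] : contains_path G s t (~: F)%SET.
  by move: Fin; rewrite finset.in_set => /asboolP.
(* [d] is the vertex [e] of the realization. It vanishes on all s-t-paths, so a zero path of [x]
   stays one along the segment from [x] to [d]. *)
pose d f : R := (f == e)%:R.
have d0 f : 0 <= d f by rewrite ler0n.
have dw p' : is_path G s p' t -> forall f, f \in p' -> d f = 0.
  by move=> /ue ep' f fp'; rewrite /d (negPf (memPn ep' _ fp')).
have de : d e = 1 by rewrite /d eqxx.
pose h (a : realization R (path_missing G s t) * R) f : R :=
  (1 - clip a.2) * bary a.1 f + clip a.2 * d f.
apply: (@contractible_weights _ _ _ h d).
- move=> f; apply: continuousrD; apply: continuousrM;
    last exact: cst_continuous.
  + by apply: continuousrB; [exact: cst_continuous|exact: continuous_clip_snd].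
  + exact: continuous_bary_fst.
  + exact: continuous_clip_snd.
- move=> [x r]; rewrite /h /=; have c0 := clip_ge0 r; have c1 := clip_le1 r.
  have x0 f := bary_ge0 x f; split => [f||].
  + by rewrite addr_ge0 // mulr_ge0 // subr_ge0.
  + have [->|cn0] := eqVneq (clip r) 0.
      have [f xf] := bary_neq0 x; exists f.
      by rewrite subr0 mul1r mul0r addr0.
    exists e; rewrite de mulr1 gt_eqF // ltr_wpDl ?lt0r ?cn0 //.
    by rewrite mulr_ge0 // subr_ge0.
  + have [q qst xq] := (face_supportP _).1 (bary_face x).
    apply/face_supportP; exists q => // f fq.
    by rewrite xq // (dw _ qst) // !mulr0 addr0.
- split=> //; first by exists e; rewrite de oner_eq0.
  by apply/face_supportP; exists p => // f; exact: dw pst f.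
- by move=> x f; rewrite /h /= clip_le0 // subr0 mul1r mul0r addr0.
- by move=> x f; rewrite /h /= clip_ge1 // subrr mul0r mul1r add0r.
Qed.

End PathMissing.

(** * Graphs without useless arcs, and contraction along a cycle *)

Section NoUselessArc.
Context {R : realType} {V : choiceType} {E : finType}.
Context {G : multigraph V E} {s t : V}.
Implicit Types (v : V) (e f : E) (p q : seq E) (x y : E -> R).

Local Notation PM := (path_missing G s t).
Local Notation rho := (reduced_cost G t).

Hypothesis on_path : forall e, exists2 p, is_path G s p t & e \in p.

Lemma target_reaches e : exists p, is_walk G (target G e) p t.
Proof.
have [p pst ep] := on_path e; have [q /andP[wq _] _] := path_after pst ep.
by exists q.
Qed.

Lemma source_reaches e : exists p, is_walk G (source G e) p t.
Proof.
by have [p wp] := target_reaches e; exists (e :: p); rewrite /= eqxx.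
Qed.

Lemma source_neq_t e : source G e != t.
Proof. by have [p pst ep] := on_path e; exact: path_source_neq pst ep. Qed.

Lemma rho_ge0 y : (forall e, 0 <= y e) -> forall e, 0 <= rho y e.
Proof.
by move=> y0 e; have [p] := target_reaches e; exact: reduced_cost_ge0.
Qed.

(** A tight path from the source of [e] to [t] is nonempty by [source_neq_t]; its first arc will
    do. *)
Lemma tight_out y e : (forall e, 0 <= y e) ->
  exists2 f, source G f = source G e & rho y f = 0.
Proof.
move=> y0; have [p wp] := source_reaches e.
have [[|f q] /andP[wq _] rq] := tight_path y0 (rho_ge0 y0) wp.
  by move: wq (source_neq_t e) => /= ->.
move: wq => /= /andP[/eqP fe _].
by exists f => //; rewrite rq ?mem_head.
Qed.

Lemma dist_source_eq0 y p : (forall e, 0 <= y e) -> is_path G s p t ->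
  (forall e, e \in p -> y e = 0) -> dist G t y s = 0.
Proof.
move=> y0 /andP[wp _] yp; apply/eqP; rewrite eq_le dist_ge0 // andbT.
by apply: le_trans (dist_le_walk y0 wp) _; rewrite big_seq big1.
Qed.

(** The length of [p] and the distances of both its ends are 0, so the nonnegative reduced costs on
    [p] sum to 0. *)
Lemma rho_eq0_path y p : (forall e, 0 <= y e) -> is_path G s p t ->
  (forall e, e \in p -> y e = 0) -> forall e, e \in p -> rho y e = 0.
Proof.
move=> y0 pst yp e ep; have /andP[wp _] := pst.
have yp0 : \sum_(f <- p) y f = 0 by rewrite big_seq big1.
have := sum_reduced_cost t y wp; rewrite dist_sink //.
rewrite (dist_source_eq0 y0 pst yp) yp0 subr0 addr0 => /eqP.
rewrite psumr_eq0 => [/allP/(_ e ep) /= /eqP //|f _]; exact: rho_ge0.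
Qed.

(* If all reduced costs vanish, so does the length of every [s]-[t]-path, and
   these paths cover all arcs. *)
Lemma rho_neq0 y : weights (Delta := PM) y -> exists e, rho y e != 0.
Proof.
move=> [y0 [e ye] /face_supportP[p pst yp]]; apply/existsP.
rewrite -negb_forall; apply: contra ye => /forallP r0.
have [q qst eq] := on_path e; have /andP[wq _] := qst.
have := sum_reduced_cost t y wq; rewrite dist_sink //.
rewrite (dist_source_eq0 y0 pst yp) subr0 addr0 big1 => [/esym/eqP|f _].
  by rewrite psumr_eq0 // => /allP/(_ e eq).
exact/eqP/r0.
Qed.

Lemma rho_face (e0 : E) y : (forall e, 0 <= y e) ->
  [set e | rho y e != 0]%SET \in faces PM.
Proof.
move=> y0; apply/face_supportP; have [p /andP[wp _] _] := on_path e0.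
have [q qst rq] := tight_path y0 (rho_ge0 y0) wp.
by exists q.
Qed.

(** A zero path of [y] remains one throughout. At [c = 0] some weight is nonzero by [rho_neq0];
    otherwise the support of [y] persists. *)
Lemma weights_interpolate y c : weights (Delta := PM) y -> 0 <= c <= 1 ->
  weights (Delta := PM) (fun e => (1 - c) * rho y e + c * y e).
Proof.
move=> wy /andP[c0 c1]; have [y0 [e ye] /face_supportP[p pst yp]] := wy.
have r0 f : 0 <= (1 - c) * rho y f.
  by apply: mulr_ge0; [rewrite subr_ge0|exact: rho_ge0].
split=> [f||]; first by rewrite addr_ge0 // mulr_ge0.
- have [->|cn0] := eqVneq c 0.
    have [f rf] := rho_neq0 wy; exists f.
    by rewrite subr0 mul1r mul0r addr0.
  exists e; rewrite gt_eqF // ltr_wpDl // mulr_gt0 // lt0r ?cn0 //.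
  by rewrite ye y0.
- apply/face_supportP; exists p => // f fp.
  by rewrite yp // (rho_eq0_path y0 pst yp fp) !mulr0 addr0.
Qed.

(* The reduced costs around a cycle have the same sum as the lengths. *)
Lemma weights_rho_cycle y u p : is_cycle G u p -> (forall e, 0 <= y e) ->
  (forall e, e \in p -> 0 < y e) -> weights (Delta := PM) (rho y).
Proof.
move=> /and3P[pn0 wp _] y0 yp.
have [e ep] : exists e, e \in p.
  by case: p pn0 {wp yp} => [//|e p] _; exists e; rewrite mem_head.
split=> [f||]; [exact: rho_ge0| |exact: rho_face e _ y0].
apply/existsP; rewrite -negb_forall; apply/negP => /forallP r0.
have := sum_reduced_cost t y wp; rewrite addrK big1 => [|f _]; last first.
  exact/eqP/r0.
move=> /esym/eqP; rewrite psumr_eq0 // => /allP/(_ e ep) /= /eqP ye.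
by have := yp e ep; rewrite ye ltxx.
Qed.

(* First [x] is moved to [rho x]; then [x] is moved to the indicator function
   of the cycle, inside the argument of [rho]. *)
Lemma cycle_contractible u p :
  is_cycle G u p -> complex_contractible R PM.
Proof.
move=> cp; right; pose d e : R := (e \in p)%:R.
have d0 e : 0 <= d e by rewrite ler0n.
have dp e : e \in p -> 0 < d e by move=> ep; rewrite /d ep ltr01.
(* Up to time 1/2, [a] is 0 and [c] falls from 1 to 0; afterwards [c] is 0 and [a] rises to 1. *)
pose a (l : R) := clip (2 * l - 1).
pose c (l : R) := 1 - clip (2 * l).
pose y (b : realization R PM * R) e := (1 - a b.2) * bary b.1 e + a b.2 * d e.
pose h (b : realization R PM * R) e :=
  (1 - c b.2) * rho (y b) e + c b.2 * y b e.
have csnd : continuous (fun b : realization R PM * R => 2 * b.2).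
  apply: continuousrM; first exact: cst_continuous.
  by move=> b; exact: cvg_snd.
have cc : continuous (fun b : realization R PM * R => c b.2).
  apply: continuousrB; first exact: cst_continuous.
  exact: continuous_clip.
have ca : continuous (fun b : realization R PM * R => a b.2).
  by apply: continuous_clip; apply: continuousrB => //; exact: cst_continuous.
have cB (f : realization R PM * R -> R) : continuous f ->
    continuous (fun b => 1 - f b).
  by move=> cf; apply: continuousrB => //; exact: cst_continuous.
have cy e : continuous (y^~ e).
  apply: continuousrD; apply: continuousrM => //; first exact: cB.
    exact: continuous_bary_fst.
  exact: cst_continuous.
apply: (@contractible_weights _ _ _ h (rho d)).
- move=> e; apply: continuousrD; apply: continuousrM => //; first exact: cB.
  exact: continuous_reduced_cost.
- move=> [x l].
  have a0 : 0 <= a l by exact: clip_ge0.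
  have a1 : a l <= 1 by exact: clip_le1.
  have x0 := bary_ge0 x.
  have [al|an0] := eqVneq (a l) 0.
    have yx : y (x, l) = bary x.
      by apply/funext => e; rewrite /y /= al subr0 mul1r mul0r addr0.
    rewrite /h yx /=; apply: weights_interpolate; last first.
      by rewrite /c subr_ge0 clip_le1 lerBlDr lerDl clip_ge0.
    by split=> //; [exact: bary_neq0|exact: bary_face].
  (* Here [2 * l > 1]: the first stage is over, and [y (x, l)] is positive on the cycle. *)
  have cl : c l = 0.
    rewrite /c clip_ge1 ?subrr //; move: an0; apply: contraNT.
    by rewrite -ltNge => l1; apply/eqP; apply: clip_le0; lra.
  have -> : h (x, l) = rho (y (x, l)).
    by apply/funext => e; rewrite /h /= cl subr0 mul1r mul0r addr0.
  have y0 e : 0 <= (1 - a l) * bary x e by rewrite mulr_ge0 // subr_ge0.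
  apply: weights_rho_cycle cp _ _ => e; first by rewrite addr_ge0 // mulr_ge0.
  by move=> ep; rewrite ltr_wpDl // mulr_gt0 ?dp // lt0r an0.
- exact: weights_rho_cycle cp d0 dp.
- move=> x e; rewrite /h /y /c /a /= mulr0 (@clip_le0 _ 0) // clip_le0 //; lra.
- move=> x e; rewrite /h /c /= clip_ge1 ?subrr ?subr0; last by lra.
  rewrite mul1r mul0r addr0; congr (rho _ e); apply/funext => f.
  by rewrite /y /a /= clip_ge1 ?subrr ?mul0r ?mul1r ?add0r //; lra.
Qed.

End NoUselessArc.

(** * One chosen arc at every nonsink *)

Section BaseArcs.
Context {R : realType} {V : choiceType} {E : finType} (G : multigraph V E).
Implicit Types (e f : E) (u : E -> R).

(** The pick succeeds, as [e] itself qualifies, and so depends only on the source of [e]. *)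
Definition base_arc e : E := odflt e [pick f | source G f == source G e].

Definition base_arcs : {set E} := [set base_arc e | e in E]%SET.

Lemma source_base_arc e : source G (base_arc e) = source G e.
Proof.
by rewrite /base_arc; case: pickP => [f /eqP //|/(_ e)]; rewrite eqxx.
Qed.

Lemma eq_base_arc e f : source G e = source G f -> base_arc e = base_arc f.
Proof.
rewrite /base_arc => ->; case: pickP => // /(_ f); by rewrite eqxx.
Qed.

Lemma base_arcsP e : reflect (base_arc e = e) (e \in base_arcs).
Proof.
apply: (iffP imsetP) => [[f _ ->]|be]; last by exists e.
exact/eq_base_arc/source_base_arc.
Qed.

(** [source] maps the base arcs bijectively onto the nonsinks. Hence the other arcs, which index the
    coordinates of the sphere, number #E - #V'. *)
Lemma card_base_arcs : #|base_arcs| = #|` nonsinks G|.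
Proof.
have -> : nonsinks G = [fset source G e | e in base_arcs]%fset.
  apply/fsetP => v; apply/imfsetP/imfsetP => -[e /= _ ->].
    by exists (base_arc e); rewrite ?source_base_arc //=; exact: imset_f.
  by exists e.
rewrite card_in_imfset /= => [|e f /base_arcsP <- /base_arcsP <-].
  by rewrite -cardE; apply: eq_card => e.
by rewrite !source_base_arc => /eq_base_arc.
Qed.

Definition class_min u e : R :=
  \big[Num.min/u e]_(f | source G f == source G e) u f.

Lemma class_min_le u e f : source G f = source G e -> class_min u e <= u f.
Proof. by move=> fe; apply: bigmin_le_cond; rewrite fe. Qed.

Lemma class_min_attained u e :
  exists2 f, source G f = source G e & class_min u e = u f.
Proof.
rewrite /class_min; elim/big_ind: _ => [|a b [f fe ->] [g ge ->]|f /eqP fe].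
- by exists e.
- by rewrite /Num.min; case: ifP => _; [exists f|exists g].
- by exists f.
Qed.

Lemma class_min_eq u e f : source G e = source G f ->
  class_min u e = class_min u f.
Proof.
suff le g h : source G g = source G h -> class_min u g <= class_min u h.
  by move=> ef; apply/eqP; rewrite eq_le !le.
by move=> gh; have [k kh ->] := class_min_attained u h;
  apply: class_min_le; rewrite kh.
Qed.

Lemma continuous_class_min (T : topologicalType) (h : T -> E -> R) e :
  (forall f, continuous (h^~ f)) -> continuous (fun a => class_min (h a) e).
Proof. by move=> ch; apply: continuousr_bigmin. Qed.

End BaseArcs.

(** * The acyclic case and spheres *)

Section Sphere.
Context {R : realType} {V : choiceType} {E : finType}.
Context {G : multigraph V E} {s t : V}.
Implicit Types (v : V) (e f : E) (p q : seq E) (x y : E -> R).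

Local Notation PM := (path_missing G s t).
Local Notation rho := (reduced_cost G t).
Local Notation base := (base_arc G).

Hypothesis on_path : forall e, exists2 p, is_path G s p t & e \in p.
Hypothesis acyclic : ~ has_cycle G.

Lemma zero_walk x : (forall e, exists2 f, source G f = source G e & x f = 0) ->
  forall v q, is_walk G v q t ->
  exists2 p, is_walk G v p t & forall e, e \in p -> x e = 0.
Proof.
move=> out v q wq.
(* The invariant is that [t] can be reached; it survives any arc, as no arc is useless. *)
apply: (acyclic_greedy_walk (Q := fun v => exists q, is_walk G v q t)) => //.
  move=> u [[|e r] /= w]; first by left; apply/eqP.
  right; move: w => /andP[/eqP <- _]; have [f fe xf] := out e.
  by exists f; split => //; exact: (target_reaches on_path).
by exists q.
Qed.

Lemma rho_fixpoint x : (forall e, 0 <= x e) ->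
  (forall e, exists2 f, source G f = source G e & x f = 0) -> rho x = x.
Proof.
move=> x0 out; have d0 v q : is_walk G v q t -> dist G t x v = 0.
  move=> /(zero_walk out)[p wp xp]; apply/eqP; rewrite eq_le dist_ge0 // andbT.
  by apply: le_trans (dist_le_walk x0 wp) _; rewrite big_seq big1.
apply/funext => e; rewrite /reduced_cost.
have [p wp] := target_reaches on_path e.
have [q wq] := source_reaches on_path e.
by rewrite (d0 _ _ wp) (d0 _ _ wq) addr0 subr0.
Qed.

(** Ensures that the map to the sphere can be normalized. If the base arc has reduced cost 0, an arc
    [e] of nonzero cost works; otherwise a tight arc [f] with the same source does. *)
Lemma rho_base_neq0 x : weights (Delta := PM) x ->
  exists2 e, e \notin base_arcs G & rho x e - rho x (base e) != 0.
Proof.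
move=> wx; have [x0 _ _] := wx; have [e re] := rho_neq0 on_path wx.
have [f fe rf] := tight_out on_path e x0.
have bf : base f = base e by exact: eq_base_arc.
have [rb|rb] := eqVneq (rho x (base e)) 0.
  exists e; last by rewrite rb subr0.
  by apply: contra re => /base_arcsP <-; apply/eqP.
exists f; last by rewrite bf rf sub0r oppr_eq0.
by apply: contra rb => /base_arcsP ff; rewrite -bf ff rf.
Qed.

Lemma path_missing_void (p0 : seq E) : is_path G s p0 t ->
  (forall e, e \in base_arcs G) -> faces PM = [set finset.set0]%SET.
Proof.
move=> p0st inB; apply/setP => F; rewrite [RHS]inE; apply/idP/eqP => [FPM|->].
  apply/setP => e; rewrite [RHS]inE; apply/negP => eF.
  (* The indicator of a nonempty face consists of valid weights, so [rho_base_neq0] would give an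
     arc outside [base_arcs G]. *)
  pose x f : R := (f \in F)%:R.
  have [|f + _] := @rho_base_neq0 x; last by rewrite inB.
  split=> [f||]; first by rewrite ler0n.
    by exists e; rewrite /x eF oner_eq0.
  rewrite (_ : finset _ = F) //; apply/setP => f; rewrite inE /x.
  by case: (f \in F); rewrite ?oner_eq0 ?eqxx.
rewrite /= finset.in_set; apply/asboolP; exists p0 => // e _.
by rewrite !inE.
Qed.

Section PositiveDimension.
Context {n : nat}.
Hypothesis dimE : #|~: base_arcs G|%SET = n.+1.

Definition free_arc (i : 'I_n.+1) : E :=
  enum_val (cast_ord (esym dimE) i).

Lemma free_arc_inj : injective free_arc.
Proof. by move=> i j /enum_val_inj /cast_ord_inj. Qed.

Lemma free_arcN i : free_arc i \notin base_arcs G.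
Proof. by rewrite -finset.in_setC; exact: enum_valP. Qed.

Lemma free_arc_surj e : e \notin base_arcs G -> exists i, free_arc i = e.
Proof.
rewrite -finset.in_setC => eB; exists (cast_ord dimE (enum_rank_in eB e)).
by rewrite /free_arc cast_ordK enum_rankK_in.
Qed.

(** At most one term, as [free_arc] is injective: [z] on the free arcs and 0 on the base arcs. *)
Definition extend (z : 'I_n.+1 -> R) e : R := \sum_(i | free_arc i == e) z i.

Lemma extend_free z i : extend z (free_arc i) = z i.
Proof.
rewrite /extend (big_pred1 i) // => j; exact: (inj_eq free_arc_inj).
Qed.

Lemma extend_base z e : extend z (base e) = 0.
Proof.
rewrite /extend big1 // => i /eqP ie; have := free_arcN i; rewrite ie.
by rewrite imset_f.
Qed.

(** Inverts the passage to differences with base arcs: the shift at each vertex keeps the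
    differences and makes the least weight there 0. *)
Definition slack (z : 'I_n.+1 -> R) e : R :=
  extend z e - class_min G (extend z) e.

Lemma slack_ge0 z e : 0 <= slack z e.
Proof. by rewrite subr_ge0 class_min_le. Qed.

Lemma slack_out z e : exists2 f, source G f = source G e & slack z f = 0.
Proof.
have [f fe ze] := class_min_attained G (extend z) e; exists f => //.
by rewrite /slack (class_min_eq _ fe) ze subrr.
Qed.

Lemma slack_base z e : slack z e - slack z (base e) = extend z e.
Proof.
rewrite /slack extend_base (class_min_eq _ (source_base_arc G e)); lra.
Qed.

Lemma weights_slack z : (exists i, z i != 0) ->
  weights (Delta := PM) (slack z).
Proof.
move=> [i zi]; split; first exact: slack_ge0.
  apply/existsP; move: zi; apply: contraR.
  rewrite negb_exists => /forallP z0; rewrite -extend_free -slack_base.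
  by rewrite !(eqP (negPn (z0 _))) subrr.
apply/face_supportP; have [q /andP[wq _] _] := on_path (free_arc i).
have [p /walk_to_path[r rst srp] zp] := zero_walk (slack_out z) wq.
by exists r => // e /srp/zp.
Qed.

Lemma path_missing_sphere :
  homotopy_equivalent R (realization R PM) (sphere R n).
Proof.
(* Normalizing [w] gives the map [f] to the sphere; normalizing [slack] gives its homotopy inverse
   [g]. *)
pose w (x : realization R PM) i : R :=
  rho (bary x) (free_arc i) - rho (bary x) (base (free_arc i)).
have wP (x : realization R PM) : weights (Delta := PM) (bary x).
  by split; [exact: bary_ge0|exact: bary_neq0|exact: bary_face].
have w0 (x : realization R PM) : exists i, w x i != 0.
  have [e /free_arc_surj[i ie] re] := rho_base_neq0 (wP x).
  by exists i; rewrite /w ie.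
have crho e : continuous (fun x : realization R PM => rho (bary x) e).
  by apply: continuous_reduced_cost => f; exact: continuous_bary.
have [|f cf fE] := normalize_sphere _ w0.
  by move=> i; apply: continuousrB.
have sP (z : sphere R n) : weights (Delta := PM) (slack (scoord z)).
  apply: weights_slack; apply/existsP.
  rewrite -negb_forall; apply/negP => /forallP z0.
  have := scoord_sum z; rewrite big1 => [/esym/eqP|i _].
    by rewrite oner_eq0.
  by rewrite (eqP (z0 i)) expr0n.
have [|g cg gE] := normalize_weights _ sP.
  move=> e.
  have cz f' : continuous (fun z : sphere R n => extend (scoord z) f').
    by apply: continuousr_sum => i; exact: continuous_scoord.
  by apply: continuousrB => //; exact: continuous_class_min.
(* [g z] has a zero arc at every nonsink, so [rho] fixes it; its differences are a positive multiple
   of [z], and [z] has norm 1. *)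
have fg z : f (g z) = z.
  have s0 := weights_sum (sP z).
  have rE : rho (bary (g z)) = bary (g z).
    apply: rho_fixpoint => [|e]; first exact: bary_ge0.
    have [e' ee' se'] := slack_out (scoord z) e.
    by exists e' => //; rewrite gE se' mul0r.
  have wE i : w (g z) i = scoord z i / \sum_e slack (scoord z) e.
    by rewrite /w rE !gE -mulrBl slack_base extend_free.
  apply: scoord_inj => i; rewrite fE.
  under eq_bigr do rewrite wE exprMn; rewrite wE -mulr_suml scoord_sum mul1r.
  by rewrite sqrtr_sqr gtr0_norm ?invr_gt0 // invrK divfK // gt_eqF.
exists f, g; split => //; last first.
  exists fst; split => // [|z]; last by rewrite /= fg.
  by apply: continuous_subspaceT => a; exact: cvg_fst.
(* [g \o f] is [rho] up to normalization, and segments join it to the identity. *)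
pose h (a : realization R PM * R) e : R :=
  (1 - clip a.2) * rho (bary a.1) e + clip a.2 * bary a.1 e.
apply: (@homotopic_weights _ _ _ h).
- move=> e; apply: continuousrD; apply: continuousrM.
  + by apply: continuousrB; [exact: cst_continuous|exact: continuous_clip_snd].
  + by apply: continuous_reduced_cost => f'; exact: continuous_bary_fst.
  + exact: continuous_clip_snd.
  + exact: continuous_bary_fst.
- by move=> a; apply: weights_interpolate => //; rewrite clip_ge0 clip_le1.
- move=> x e; have x0 := bary_ge0 x.
  have hE e' : h (x, 0) e' = rho (bary x) e'.
    by rewrite /h /= clip_le0 // subr0 mul1r mul0r addr0.
  under eq_bigr do rewrite hE; rewrite hE /= gE.
  set N := Num.sqrt (\sum_i w x i ^+ 2).
  have N0 : 0 < N by rewrite sqrtr_gt0 sum_sqr_gt0.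
  have eE e' : extend (scoord (f x)) e' =
      (rho (bary x) e' - rho (bary x) (base e')) / N.
    have [/base_arcsP eB|/free_arc_surj[i <-]] := boolP (e' \in base_arcs G).
      by rewrite -[in LHS]eB extend_base eB subrr mul0r.
    by rewrite extend_free fE.
  have sE e' : slack (scoord (f x)) e' = rho (bary x) e' / N.
    have [k ke rk] := tight_out on_path e' x0.
    (* The least reduced cost at the vertex is 0, attained at [k], so the least difference is that
       of [k]. *)
    have mE : class_min G (extend (scoord (f x))) e' =
        - rho (bary x) (base e') / N.
      apply/eqP; rewrite eq_le; apply/andP; split.
        rewrite (le_trans (class_min_le _ ke)) // eE rk sub0r.
        by rewrite (eq_base_arc ke).
      have [k' k'e ->] := class_min_attained G (extend (scoord (f x))) e'.
      rewrite eE (eq_base_arc k'e) ler_pM2r ?invr_gt0 // lerDr.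
      exact: (rho_ge0 on_path).
    by rewrite /slack mE eE -mulrBl opprK subrK.
  rewrite (eq_bigr _ (fun e _ => sE e)) sE -mulr_suml -mulf_div divff ?mulr1 //.
  by rewrite gt_eqF // invr_gt0.
- move=> x e; have hE e' : h (x, 1) e' = bary x e'.
    by rewrite /h /= clip_ge1 // subrr mul0r mul1r add0r.
  by under eq_bigr do rewrite hE; rewrite hE bary_sum divr1.
Qed.

End PositiveDimension.

End Sphere.

(** * Case distinction for the two homotopy types *)

Theorem theorem1p9 (R : realType) (V : choiceType) (E : finType)
    (G : multigraph V E) (s t : V) :
  let bad := (exists e : E, useless_arc G s t e) \/ has_cycle G \/
             (#|E| = 0%N /\ s <> t) in
  (bad -> complex_contractible R (path_missing G s t)) /\
  (~ bad -> complex_sphere R (path_missing G s t)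
              (#|E|%:Z - #|` nonsinks G|%:Z - 1)).
Proof.
move=> bad.
have on_path : ~ (exists e, useless_arc G s t e) ->
    forall e, exists2 p, is_path G s p t & e \in p.
  move=> nu e; apply: contrapT => np; case: nu; exists e => p pst.
  by apply/negP => ep; case: np; exists p.
split=> [|nbad].
  (* Useless arcs come first, since the contraction along a cycle assumes that there are none. *)
  have [[e /useless_arc_contractible //]|nu] :=
    pselect (exists e, useless_arc G s t e).
  case=> [//|[[u [p cp]]|[E0 st]]].
    exact: (cycle_contractible (on_path nu) cp).
  (* Without arcs only trivial walks remain, and none joins [s] to [t]: there are no faces. *)
  left; apply/setP => F; rewrite [RHS]inE /= finset.in_set.
  apply/asboolP => -[[|e p] pst _].
    by move: pst; rewrite /is_path /= andbT => /eqP.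
  by have := enum_rank e; rewrite E0 => -[].
have nu : ~ exists e, useless_arc G s t e by move=> ue; apply: nbad; left.
have acyclic : ~ has_cycle G by move=> cyc; apply: nbad; right; left.
have {}on_path := on_path nu.
have dimE : #|E| = (#|base_arcs G| + #|~: base_arcs G|%SET)%N by rewrite cardsC.
(* The dimension becomes the number of non-base arcs minus 1, which is -1 if all arcs are base
   arcs. *)
rewrite -card_base_arcs dimE PoszD [X in X - _ - _]addrC addrK.
case dim : #|_| => [|n]; last first.
  rewrite -[n.+1]addn1 PoszD addrK; exact: path_missing_sphere dim.
(* Any arc lies on such a path; if there are no arcs, then [s = t] and the trivial path serves. *)
have [p pst] : exists p, is_path G s p t.
  have [E0|] := eqVneq #|E| 0%N; last first.
    by rewrite -lt0n => /card_gt0P[e _]; have [p] := on_path e; exists p.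
  exists [::]; rewrite /is_path /= andbT; apply/eqP; apply: contrapT => st.
  by apply: nbad; right; right.
apply: (path_missing_void (R := R) on_path pst) => e.
move/eqP: dim; rewrite cards_eq0 => /eqP/setP/(_ e).
by rewrite !inE => /negbFE.
Qed.
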